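(* Let $n\ge2$, let $x_1,\dots,x_n,x_1'\in[0,1]$, and let $Z$ be a real random variable (the noise mechanism). Let $P_i$ be the law of $x_i+Z$ for $i\in\{1,\dots,n\}$ and let $P_1'$ be the law of $x_1'+Z$. Let $\mathbb{P}_n=\mathbb{E}_{\pi\sim\mathrm{Unif}(S_n)}\left[\otimes_{i=1}^nP_{\pi(i)}\right]$ be the law of the shuffled outputs for $(P_1,P_2,\dots,P_n)$, and let $\mathbb{P}_n'$ be the law of the shuffled outputs for $(P_1',P_2,\dots,P_n)$, i.e. $\mathbb{P}_n'=\mathbb{E}_{\pi\sim\mathrm{Unif}(S_n)}\left[\otimes_{i=1}^nP'_{\pi(i)}\right]$ with $P_i'=P_i$ for $i\ge2$. For $\varepsilon\in(0,1)$, both the Laplace mechanism $Z\sim\mathrm{Lap}(\frac1\varepsilon)$ and the Gaussian mechanism $Z\sim\mathcal{N}(0,\frac1{\varepsilon^2})$ achieve $$\mathrm{TV}(\mathbb{P}_n,\mathbb{P}_n')=O\left(\frac{\varepsilon}{\sqrt n}\right),$$ where the constant hidden in $O(\cdot)$ is absolute.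
   Context: $S_n$ is the permutation group of $\{1,\dots,n\}$. $\mathrm{TV}(P,Q)=\frac12\int|\mathrm{d}P-\mathrm{d}Q|$. $\mathrm{Lap}(b)$ is the Laplace distribution on $\mathbb{R}$ with density $\frac1{2b}e^{-|z|/b}$. *)

(* Defs.v *)
From HB Require Import structures.
From mathcomp Require Import all_boot all_order all_algebra perm.
From mathcomp Require Import all_classical all_reals all_analysis measurable_realfun.

Set Implicit Arguments.
Unset Strict Implicit.
Unset Printing Implicit Defensive.

Import Order.TTheory GRing.Theory Num.Theory.
Import numFieldNormedType.Exports.

Local Open Scope classical_set_scope.
Local Open Scope ring_scope.

Section product_law.
Context d (T : measurableType d) (R : realType).

Definition tuple_cons n (z : T * n.-tuple T) : n.+1.-tuple T :=
  [tuple of z.1 :: z.2].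

Lemma measurable_tuple_cons n : measurable_fun [set: T * n.-tuple T] (@tuple_cons n).
Proof. exact: measurable_cons. Qed.

HB.instance Definition _ n :=
  isMeasurableFun.Build _ _ _ _ (@tuple_cons n) (@measurable_tuple_cons n).

(* The n-fold product P_0 (x) ... (x) P_(n-1) on n.-tuple T, whose sigma-algebra
   is generated by the coordinate maps; product_law_box below characterizes it. *)
Fixpoint product_law n : ('I_n -> probability T R) -> probability (n.-tuple T) R :=
  if n is m.+1 then fun P =>
    distribution (P ord0 \x product_law (fun i => P (lift ord0 i)))%E
                 (@tuple_cons m)
  else fun=> dirac [tuple].

Lemma product_law_box n (P : 'I_n -> probability T R) (A : 'I_n -> set T) :
  (forall i, measurable (A i)) ->
  (product_law P [set t | forall i, A i (tnth t i)] = \prod_(i < n) P i (A i))%E.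
Proof.
elim: n P A => [|n IH] P A mA.
  rewrite big_ord0 /= diracE mem_set//.
  by move=> [].
rewrite big_ord_recl -IH//.
transitivity ((P ord0 \x product_law (fun i => P (lift ord0 i)))%E
  (A ord0 `*` [set t | forall i, A (lift ord0 i) (tnth t i)])).
  rewrite /= /distribution /pushforward/=; congr (product_measure1 _ _ _).
  apply/seteqP; split => -[a t]/=.
    move=> h; split; first exact: (h ord0).
    by move=> i; have := h (lift ord0 i); rewrite tnthS.
  move=> [a0 h] i; case: (unliftP ord0 i) => [j ->|->] //.
  by rewrite tnthS; exact: h.
rewrite product_measure1E//.
have -> : [set t : n.-tuple T | forall i, A (lift ord0 i) (tnth t i)] =
   \bigcap_(i in [set: 'I_n]) ((@tnth n T ^~ i) @^-1` A (lift ord0 i)).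
  by apply/seteqP; split => t /= h i; [move=> _; exact: h|exact: h].
apply: fin_bigcap_measurable => // i _.
by rewrite -[X in measurable X]setTI; exact: measurable_tnth.
Qed.

End product_law.

Section shuffled_law.
Context d (T : measurableType d) (R : realType) (n : nat).
Variable P : 'I_n -> probability T R.
Local Open Scope ereal_scope.

Definition shuffled_law (A : set (n.-tuple T)) : \bar R :=
  (n`!%:R^-1)%:E * \sum_(s : 'S_n) product_law (fun i => P (s i)) A.

Let shuffled_law0 : shuffled_law set0 = 0.
Proof. by rewrite /shuffled_law big1 ?mule0// => s _; rewrite measure0. Qed.

Let shuffled_law_ge0 A : 0 <= shuffled_law A.
Proof. by rewrite mule_ge0 ?lee_fin// sume_ge0. Qed.

Let shuffled_law_sigma_additive : semi_sigma_additive shuffled_law.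
Proof.
move=> F mF tF mUF.
rewrite [X in _ --> X](_ : _ =
    lim ((fun m => \sum_(0 <= i < m) shuffled_law (F i)) @ \oo)).
  by apply: is_cvg_ereal_nneg_natsum => k _; exact: shuffled_law_ge0.
rewrite nneseriesZl//; last by move=> k _; exact: sume_ge0.
rewrite nneseries_sum//; congr (_ * _); apply: eq_bigr => /= s _.
exact: measure_semi_bigcup.
Qed.

HB.instance Definition _ := isMeasure.Build _ _ _ shuffled_law
  shuffled_law0 shuffled_law_ge0 shuffled_law_sigma_additive.

Let shuffled_law_setT : shuffled_law setT = 1.
Proof.
rewrite /shuffled_law; under eq_bigr do rewrite probability_setT.
by rewrite sumEFin sumr_const -EFinM card_Sn mulVf// pnatr_eq0 -lt0n fact_gt0.
Qed.

HB.instance Definition _ := Measure_isProbability.Build _ _ _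
  shuffled_law shuffled_law_setT.

End shuffled_law.

Section total_variation_distance.
Context d (T : measurableType d) (R : realType).
Variables P Q : {finite_measure set T -> \bar R}.
Local Open Scope ereal_scope.

Definition diff_charge : {charge set T -> \bar R} :=
  cadd (charge_of_finite_measure P) (copp (charge_of_finite_measure Q)).

(* The integral of |dP - dQ| is the total mass of the variation |P - Q|. The
   library builds it from a Hahn decomposition of P - Q: any one will do (tvE). *)
Definition tv : \bar R :=
  let: exist p hp := cid (Hahn_decomposition diff_charge) in
  let: exist q hpq := cid hp in
  (2^-1)%:E * charge_variation hpq setT.

Lemma tvE p q (hpq : hahn_decomposition diff_charge p q) :
  tv = (2^-1)%:E * charge_variation hpq setT.
Proof.
rewrite /tv; case: cid => p' hp'; case: cid => q' hpq'.
have [h1 h2] := Hahn_decomposition_uniq hpq hpq' measurableT.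
congr (_ * _).
rewrite /charge_variation !jordan_posE !jordan_negE !cjordan_posE !cjordan_negE.
by rewrite /crestr0 !mem_set//= /crestr h1 h2.
Qed.

End total_variation_distance.

Section laplace_distribution.
Context (R : realType).

Definition laplace_pdf (b z : R) : R := (2 * b)^-1 * expR (- `|z| / b).

Definition laplace_prob (b : R) (A : set R) : \bar R :=
  (\int[lebesgue_measure]_(z in A) (laplace_pdf b z)%:E)%E.

End laplace_distribution.

Section mechanism.
Context d (Om : measurableType d) (R : realType) (Pr : probability Om R).
Variable Z : {RV Pr >-> R}.

Definition has_law (mu : set R -> \bar R) :=
  forall A, measurable A -> distribution Pr Z A = mu A.

Definition output (x : R) (w : Om) : R := x + Z w.

Let measurable_output x : measurable_fun [set: Om] (output x).
Proof. exact: measurable_funD. Qed.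

HB.instance Definition _ x :=
  isMeasurableFun.Build _ _ _ _ (output x) (measurable_output x).

Definition output_law (x : R) : probability R R := distribution Pr (output x).

End mechanism.

(* Users 1, ..., n are indexed from 0 in 'I_n: the first one has index 0. *)
Definition replace_first (X : Type) n (x : 'I_n -> X) (y : X) (i : 'I_n) : X :=
  if i == 0%N :> nat then y else x i.

(* Main.v *)
(* Every output law P_i dominates g Q for one "blanket" law Q and a constant
   g > 0, so a user other than the first can be thought of as sampling from Q
   with probability g and from some other law otherwise.  Given that m users
   sample from Q, the shuffled difference is the integral of a function with
   values in [0, 1], symmetric in m + 1 coordinates, against h(y_1) dQ^(m+1)
   with h = d(P_1 - P_1')/dQ.  By symmetry h(y_1) may be replaced by the average
   of the h(y_j), whose L^2 norm is ||h|| / sqrt(m + 1) because h has mean zero.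
   Averaging over m costs a factor depending on g only, and ||h|| = O(eps). *)

From HB Require Import structures.
Require Import Defs.
From mathcomp Require Import all_boot all_order all_algebra perm.
From mathcomp Require Import all_classical all_reals all_analysis measurable_realfun.
From mathcomp Require Import ring lra.

Set Implicit Arguments.
Unset Strict Implicit.
Unset Printing Implicit Defensive.

Import Order.TTheory GRing.Theory Num.Theory.
Import numFieldNormedType.Exports.

Local Open Scope classical_set_scope.
Local Open Scope ring_scope.

(** * Integration on product laws *)

(** Total variation is tested on one measurable set [A] at a time. Conditioning on who samples from
    Q becomes an algebraic expansion, because the mass that a shuffled law gives to [A] is
    multilinear in the densities with respect to Q. No binomial law for m appears: users are split
    one at a time, and the bound 1 / sqrt s survives each split if s grows by g / 2 only; growth by
    the mean g is excluded by the convexity of 1 / sqrt s. The lower bound g concerns likelihood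
    ratios on the whole line. A shifted Laplace density satisfies it against the centered one; a
    shifted Gaussian density does not, whence a narrower Gaussian blanket and the numerical work on
    exponents. *)

Section density.
Context d (T : measurableType d) (R : realType).
Local Open Scope ereal_scope.

(** The Radon-Nikodym derivative of [nu] equals [p] almost everywhere, since both integrate to [nu]
    over every measurable set; its change-of-variables formula then passes to [p]. *)
Lemma ge0_integral_density (nu : {finite_measure set T -> \bar R})
    (mu : {sigma_finite_measure set T -> \bar R}) (p : T -> R) (g : T -> \bar R) :
  measurable_fun setT p -> (forall x, 0 <= p x)%R ->
  (forall A, measurable A -> nu A = \int[mu]_(x in A) (p x)%:E) ->
  measurable_fun setT g -> (forall x, 0 <= g x) ->
  \int[nu]_x g x = \int[mu]_x (g x * (p x)%:E).
Proof.
move=> mp p0 nuE mg g0.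
have mpE : measurable_fun setT (EFin \o p) by exact/measurable_EFinP.
have numu : nu `<< mu.
  apply/null_content_dominatesP => A mA muA0; rewrite nuE//.
  by apply: null_set_integral => //; exact: measurable_funTS.
have ip : mu.-integrable setT (EFin \o p).
  apply/integrableP; split => //.
  under eq_integral do rewrite /= ger0_norm//.
  by rewrite -nuE// ltey_eq fin_num_measure.
rewrite -(Radon_Nikodym_SigmaFinite.change_of_variables numu)//.
have fi := Radon_Nikodym_SigmaFinite.f_integrable numu.
have mf := measurable_int _ fi.
apply: ae_eq_integral => //.
- exact: emeasurable_funM.
- exact: emeasurable_funM.
- apply: ae_eqe_mul2l; apply: integral_ae_eq => //.
  by move=> A _ mA; rewrite -Radon_Nikodym_SigmaFinite.f_integral// nuE.
Qed.

End density.

Section product_law_integral.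
Context d (T : measurableType d) (R : realType).

Lemma ge0_integral_product_lawS n (P : 'I_n.+1 -> probability T R)
    (G : n.+1.-tuple T -> \bar R) :
  measurable_fun setT G -> (forall t, 0 <= G t)%E ->
  (\int[product_law P]_t G t =
   \int[P ord0]_z \int[product_law (fun i => P (lift ord0 i))]_t
     G (tuple_cons (z, t)))%E.
Proof.
move=> mG G0; rewrite /= ge0_integral_distribution//.
rewrite (fubini_tonelli1 (G \o @tuple_cons d T n))//.
- by apply: measurableT_comp => //; exact: measurable_tuple_cons.
- by move=> x /=.
Qed.

Definition coord_prod n (u : 'I_n -> T -> R) (t : n.-tuple T) : R :=
  \prod_i u i (tnth t i).

Lemma coord_prodS n (u : 'I_n.+1 -> T -> R) z t :
  coord_prod u (tuple_cons (z, t)) =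
  u ord0 z * coord_prod (fun i => u (lift ord0 i)) t.
Proof.
rewrite /coord_prod big_ord_recl; congr (_ * _).
by apply: eq_bigr => i _; rewrite tnthS.
Qed.

Lemma measurable_coord_prod n (u : 'I_n -> T -> R) :
  (forall i, measurable_fun setT (u i)) -> measurable_fun setT (coord_prod u).
Proof.
move=> mu; apply: measurable_prod => i _.
by apply: measurableT_comp => //; exact: measurable_tnth.
Qed.

(** Integrability and value go through one induction: the factors may be signed, so Fubini needs the
    integrability of the tail product. *)
Lemma coord_prod_integrable n (P : 'I_n -> probability T R) (u : 'I_n -> T -> R) :
  (forall i, (P i).-integrable setT (EFin \o u i)) ->
  (product_law P).-integrable setT (EFin \o coord_prod u) /\
  \int[product_law P]_t coord_prod u t = \prod_i \int[P i]_x u i x.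
Proof.
elim: n P u => [|n IH] P u iu.
  have c1 : coord_prod u = cst 1.
    by apply/funext => t; rewrite /coord_prod big_ord0.
  rewrite c1; split; first exact: (finite_measure_integrable_cst _ 1).
  rewrite Rintegral_cst// big_ord0 mul1r.
  exact: (congr1 fine (probability_setT (product_law P))).
have [iV eV] := IH (fun i => P (lift ord0 i)) (fun i => u (lift ord0 i))
  (fun i => iu (lift ord0 i)).
set V := coord_prod _ in iV eV.
pose m2 := product_law (fun i => P (lift ord0 i)).
have mu0 : measurable_fun setT (u ord0).
  by apply/measurable_EFinP; exact: measurable_int (iu ord0).
have mV : measurable_fun setT V.
  by apply/measurable_EFinP; exact: measurable_int iV.
have fE : EFin \o coord_prod u \o @tuple_cons d T n =
    fun z => (u ord0 z.1 * V z.2)%:E.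
  by apply/funext => -[z t] /=; rewrite coord_prodS.
have mf : measurable_fun setT (fun z : T * n.-tuple T => (u ord0 z.1 * V z.2)%:E).
  apply/measurable_EFinP/measurable_funM.
  - by apply: (measurableT_comp mu0); exact: measurable_fst.
  - by apply: (measurableT_comp mV); exact: measurable_snd.
have intf : (P ord0 \x m2)%E.-integrable setT
    (fun z => (u ord0 z.1 * V z.2)%:E).
  apply/integrable12ltyP => //=.
  under eq_integral => x _.
    under eq_integral do rewrite normrM EFinM.
    rewrite ge0_integralZl//; last first.
      by apply/measurable_EFinP; exact: measurableT_comp.
    over.
  rewrite ge0_integralZr//=.
  - apply: lte_mul_pinfty.
    + exact: integral_ge0.
    + by apply/integrable_fin_num => //; exact: (integrable_abse (iu ord0)).
    + by move/integrableP: iV => [].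
  - by apply/measurable_EFinP; exact: measurableT_comp.
  - exact: integral_ge0.
have mprod : measurable_fun setT (EFin \o coord_prod u).
  apply/measurable_EFinP; apply: measurable_coord_prod => i.
  by apply/measurable_EFinP; exact: measurable_int (iu i).
have ipr : (product_law P).-integrable setT (EFin \o coord_prod u).
  apply: (integrable_pushforward (measurable_tuple_cons (n:=n))) => //.
  by rewrite preimage_setT fE.
split => //.
rewrite {1}/Rintegral.
have -> : (\int[product_law P]_t (coord_prod u t)%:E =
    \int[P ord0 \x m2]_z (u ord0 z.1 * V z.2)%:E)%E.
  rewrite -fE [LHS]integral_distribution//.
  by rewrite fE.
rewrite -integral12_prod_meas1//= /fubini_F/=.
rewrite big_ord_recl -eV.
under eq_integral => x _.
  under eq_integral do rewrite EFinM.
  rewrite integralZl//.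
  rewrite -[(\int[_]_y (V y)%:E)%E]fineK ?integrable_fin_num//.
  over.
rewrite integralZr//; last exact: (iu ord0).
by rewrite fineM//; apply: integrable_fin_num => //; exact: (iu ord0).
Qed.

End product_law_integral.

Section product_law_density.
Context d (T : measurableType d) (R : realType) (Q : probability T R).

(** A general nonnegative [G], and not just an indicator, lets the induction hypothesis apply to the
    sections of [G] at a fixed first coordinate. *)
Lemma ge0_integral_product_law_density n (P : 'I_n -> probability T R)
    (p : 'I_n -> T -> R) (G : n.-tuple T -> \bar R) :
  (forall i, measurable_fun setT (p i)) -> (forall i x, 0 <= p i x) ->
  (forall i A, measurable A -> P i A = \int[Q]_(x in A) (p i x)%:E)%E ->
  measurable_fun setT G -> (forall t, 0 <= G t)%E ->
  (\int[product_law P]_t G t =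
   \int[product_law (fun=> Q)]_t (G t * (coord_prod p t)%:E))%E.
Proof.
elim: n P p G => [|n IH] P p G mp p0 PE mG G0.
  by apply: eq_integral => t _; rewrite /coord_prod big_ord0 mule1.
have mtc z : measurable_fun setT (fun t : n.-tuple T => tuple_cons (z, t)).
  by apply: (measurableT_comp (measurable_tuple_cons (n:=n))).
have mtcp : measurable_fun setT (coord_prod (fun i => p (lift ord0 i))).
  exact: measurable_coord_prod.
have cp0 m (u : 'I_m -> T -> R) t : (forall i x, 0 <= u i x) -> 0 <= coord_prod u t.
  by move=> u0; apply: prodr_ge0.
pose H z := (\int[product_law (fun=> Q)]_t
  (G (tuple_cons (z, t)) * (coord_prod (fun i => p (lift ord0 i)) t)%:E))%E.
have mGc : measurable_fun setT (fun zt : T * n.-tuple T =>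
    (G (tuple_cons zt) * (coord_prod (fun i => p (lift ord0 i)) zt.2)%:E)%E).
  apply: emeasurable_funM.
    by apply: (measurableT_comp mG); exact: measurable_tuple_cons.
  by apply/measurable_EFinP; apply: (measurableT_comp mtcp); exact: measurable_snd.
have HE z : (\int[product_law (fun i => P (lift ord0 i))]_t G (tuple_cons (z, t)) =
    H z)%E.
  apply: IH => //; first by move=> i A; exact: PE.
  exact: (measurableT_comp mG (mtc z)).
rewrite ge0_integral_product_lawS//.
under eq_integral do rewrite HE.
rewrite (ge0_integral_density (mu := Q) (mp ord0) (p0 ord0) (PE ord0)); first last.
- by move=> z; apply: integral_ge0 => t _; rewrite mule_ge0// lee_fin cp0.
- apply: (measurable_fun_fubini_tonelli_F (fun zt : T * n.-tuple T =>
    (G (tuple_cons zt) * (coord_prod (fun i => p (lift ord0 i)) zt.2)%:E)%E)) => //.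
  by move=> zt; rewrite mule_ge0// lee_fin cp0.
rewrite ge0_integral_product_lawS//; first last.
- by move=> t; rewrite mule_ge0// lee_fin cp0.
- apply: emeasurable_funM => //; apply/measurable_EFinP.
  exact: measurable_coord_prod.
apply: eq_integral => z _; rewrite /H -ge0_integralZr ?lee_fin//; first last.
- by move=> t _; rewrite mule_ge0// lee_fin cp0.
- apply: emeasurable_funM; first exact: (measurableT_comp mG (mtc z)).
  exact/measurable_EFinP.
apply: eq_integral => t _.
by rewrite coord_prodS [in RHS]mulrC EFinM muleA.
Qed.

Lemma product_law_density n (P : 'I_n -> probability T R) (p : 'I_n -> T -> R) A :
  (forall i, measurable_fun setT (p i)) -> (forall i x, 0 <= p i x) ->
  (forall i A, measurable A -> P i A = \int[Q]_(x in A) (p i x)%:E)%E ->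
  measurable A ->
  (product_law P A =
   (\int[product_law (fun=> Q)]_(t in A) coord_prod p t)%R%:E)%E.
Proof.
move=> mp p0 PE mA.
have ip i : Q.-integrable setT (EFin \o p i).
  apply/integrableP; split; first exact/measurable_EFinP.
  under eq_integral do rewrite /= ger0_norm//.
  by rewrite -PE// probability_setT ltry.
have [icp _] := coord_prod_integrable (P := fun=> Q) ip.
rewrite /Rintegral fineK; last first.
  by apply: integrable_fin_num => //; exact: integrableS icp.
have -> : product_law P A = (\int[product_law P]_t (\1_A t)%:E)%E.
  by rewrite integral_indic// setIT.
rewrite (ge0_integral_product_law_density mp p0 PE)//; last first.
  by apply/measurable_EFinP; exact: measurable_indic.
rewrite [RHS]integral_mkcond; apply: eq_integral => t _.
by rewrite muleC epatch_indic.
Qed.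

End product_law_density.

(** * The multilinear form behind the shuffled law *)

Definition upd (I : eqType) (X : Type) (u : I -> X) (i : I) (v : X) : I -> X :=
  fun j => if j == i then v else u j.

Section upd_theory.
Context (I : eqType) (X : Type).
Implicit Types (u : I -> X) (v w : X).

Lemma upd_same u i v : upd u i v i = v. Proof. by rewrite /upd eqxx. Qed.

Lemma upd_neq u i j v : j != i -> upd u i v j = u j.
Proof. by rewrite /upd => /negbTE ->. Qed.

Lemma upd_id u i : upd u i (u i) = u.
Proof. by apply/funext => j; rewrite /upd; case: eqP => [->|]. Qed.

Lemma updC u i j v w : i != j -> upd (upd u i v) j w = upd (upd u j w) i v.
Proof.
move=> ij; apply/funext => k; rewrite /upd.
by case: (eqVneq k j) => // ->; rewrite eq_sym (negbTE ij).
Qed.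

End upd_theory.

Lemma Rintegral_sum d (T : measurableType d) (R : realType)
    (mu : {measure set T -> \bar R}) (D : set T) (I : Type) (s : seq I)
    (P : pred I) (f : I -> T -> R) :
  measurable D -> (forall i, P i -> mu.-integrable D (EFin \o f i)) ->
  \int[mu]_(x in D) (\sum_(i <- s | P i) f i x) =
  \sum_(i <- s | P i) \int[mu]_(x in D) f i x.
Proof.
move=> mD fi; elim: s => [|i s IH].
  under eq_Rintegral do rewrite big_nil.
  by rewrite Rintegral_cst// mul0r big_nil.
under eq_Rintegral do rewrite big_cons.
rewrite big_cons; case: ifPn => // Pi; rewrite RintegralD ?IH//; first exact: fi.
have := @integrable_sum _ _ _ mu D mD I s P (fun i => EFin \o f i) fi.
by apply: eq_integrable => // x _ /=; rewrite sumEFin.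
Qed.

Section multilinear_form.
Context d (T : measurableType d) (R : realType) (Q : probability T R) (n : nat).
Variable A : set (n.-tuple T).
Hypothesis mA : measurable A.
Implicit Types (u : 'I_n -> T -> R) (v w h : T -> R).

Let mu := product_law (fun _ : 'I_n => Q).
Local Notation L1 v := (Q.-integrable setT (EFin \o v)).

Definition tensor_int u : R := \int[mu]_(t in A) coord_prod u t.

Lemma coord_prod_upd u i v t :
  coord_prod (upd u i v) t =
  v (tnth t i) * \prod_(j | j != i) u j (tnth t j).
Proof.
rewrite /coord_prod (bigD1 i)//= upd_same; congr (_ * _).
by apply: eq_bigr => j ji; rewrite upd_neq.
Qed.

Lemma L1_upd u i v : (forall i, L1 (u i)) -> L1 v -> forall j, L1 (upd u i v j).
Proof. by move=> iu iv j; rewrite /upd; case: ifP. Qed.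

Lemma L1_coord_prod u : (forall i, L1 (u i)) -> mu.-integrable setT (EFin \o coord_prod u).
Proof. by move=> iu; have [] := coord_prod_integrable (P := fun=> Q) iu. Qed.

Lemma tensor_int_linear u i v w (a b : R) :
  (forall i, L1 (u i)) -> L1 v -> L1 w ->
  tensor_int (upd u i (fun x => a * v x + b * w x)) =
  a * tensor_int (upd u i v) + b * tensor_int (upd u i w).
Proof.
move=> iu iv iw.
have ii z : L1 z -> mu.-integrable A (EFin \o coord_prod (upd u i z)).
  move=> iz; apply: (integrableS measurableT) => //.
  by apply: L1_coord_prod; exact: L1_upd.
rewrite /tensor_int -!RintegralZl//; try exact: (ii _ iv); try exact: (ii _ iw).
rewrite -RintegralD//; last 2 first.
- exact: (integrableZl mA a (ii _ iv)).
- exact: (integrableZl mA b (ii _ iw)).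
by apply: eq_Rintegral => t _; rewrite !coord_prod_upd; ring.
Qed.

(* AM-GM, |S| w <= (l w + S^2 w / l) / 2 with S = \sum_(j in J) h(t_j), replaces
   Cauchy-Schwarz; the cross terms h(t_i) h(t_j) w integrate to zero. *)
Lemma tensor_int_sum_le (J : {set 'I_n}) u h (k : R) :
  (forall i, L1 (u i)) -> (forall i x, 0 <= u i x) ->
  (forall i, \int[Q]_x u i x = 1) -> (forall j, j \in J -> u j = cst 1) ->
  L1 h -> \int[Q]_x h x = 0 ->
  L1 (fun x => h x ^+ 2) -> \int[Q]_x (h x ^+ 2) <= k ^+ 2 -> 0 < k ->
  (0 < #|J|)%N ->
  `|\sum_(j in J) tensor_int (upd u j h)| <= k * Num.sqrt #|J|%:R.
Proof.
move=> iu u0 u1 uJ ih h0 ih2 hk k0 J0.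
pose w := coord_prod u.
have w0 t : 0 <= w t by apply: prodr_ge0.
(* Slots in [J] hold the constant 1, so writing v there just multiplies w. *)
have wupd j v t : j \in J -> coord_prod (upd u j v) t = v (tnth t j) * w t.
  move=> jJ; rewrite coord_prod_upd /w /coord_prod [in RHS](bigD1 j)//=.
  by rewrite uJ// mul1r.
pose S t := \sum_(j in J) h (tnth t j).
(* Each h(t_i) h(t_j) w is again a coordinate product, so its integral factorizes; for i != j one
   factor is the mean of h, which is zero. *)
pose U i j := if i == j then upd u i (fun x => h x ^+ 2) else upd (upd u i h) j h.
have UE i j t : i \in J -> j \in J ->
    coord_prod (U i j) t = h (tnth t i) * h (tnth t j) * w t.
  move=> iJ jJ; rewrite /U; case: eqVneq => [<-|ij].
    by rewrite wupd// expr2.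
  rewrite coord_prod_upd (bigD1 i)//= upd_same.
  rewrite /w /coord_prod [in RHS](bigD1 j)//= [in RHS](bigD1 i)//= !uJ// !mul1r.
  rewrite mulrA [h _ * h _]mulrC; congr (_ * _).
  by apply: eq_bigr => l /andP[_ li]; rewrite upd_neq.
have iU i j : forall l, L1 (U i j l).
  by rewrite /U; case: eqP => _; do ?apply: L1_upd.
have intU i j : i \in J -> j \in J ->
    \int[mu]_t coord_prod (U i j) t = if i == j then \int[Q]_x (h x ^+ 2) else 0.
  move=> iJ jJ; rewrite (proj2 (coord_prod_integrable (P := fun=> Q) (iU i j))).
  rewrite /U; case: eqVneq => [_|ij].
    rewrite (bigD1 i)//= upd_same big1 ?mulr1// => l li.
    by rewrite upd_neq.
  by rewrite (bigD1 j)//= upd_same h0 mul0r.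
have iw : mu.-integrable setT (EFin \o w) by exact: L1_coord_prod.
have iSw : mu.-integrable setT (EFin \o (fun t => S t * w t)).
  have := @integrable_sum _ _ _ mu setT measurableT _ (index_enum 'I_n)
    (mem J) (fun j => EFin \o coord_prod (upd u j h)).
  move=> /(_ (fun j _ => L1_coord_prod (L1_upd j iu ih))).
  apply: eq_integrable => // t _ /=; rewrite sumEFin mulr_suml.
  by congr EFin; apply: eq_bigr => j jJ; rewrite wupd.
have S2E t : S t ^+ 2 * w t = \sum_(i in J) \sum_(j in J) coord_prod (U i j) t.
  rewrite expr2 mulr_suml mulr_suml; apply: eq_bigr => i iJ.
  rewrite mulr_sumr mulr_suml; apply: eq_bigr => j jJ.
  by rewrite UE.
have iU2 i : mu.-integrable setT
    (EFin \o (fun t => \sum_(j in J) coord_prod (U i j) t)).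
  have := @integrable_sum _ _ _ mu setT measurableT _ (index_enum 'I_n)
    (mem J) (fun j => EFin \o coord_prod (U i j)).
  move=> /(_ (fun j _ => L1_coord_prod (iU i j))).
  by apply: eq_integrable => // t _ /=; rewrite sumEFin.
have iS2 : mu.-integrable setT (EFin \o (fun t => S t ^+ 2 * w t)).
  have := @integrable_sum _ _ _ mu setT measurableT _ (index_enum 'I_n)
    (mem J) (fun i => EFin \o (fun t => \sum_(j in J) coord_prod (U i j) t)).
  move=> /(_ (fun i _ => iU2 i)).
  by apply: eq_integrable => // t _ /=; rewrite sumEFin S2E.
have intS2 : \int[mu]_t (S t ^+ 2 * w t) = #|J|%:R * \int[Q]_x (h x ^+ 2).
  under eq_Rintegral do rewrite S2E.
  rewrite Rintegral_sum//; transitivity (\sum_(i in J) \int[Q]_x (h x ^+ 2)).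
    apply: eq_bigr => i iJ; rewrite Rintegral_sum//; last first.
      by move=> j _; exact: L1_coord_prod.
    rewrite (bigD1 i)//= intU// eqxx big1 ?addr0// => j /andP[jJ ji].
    by rewrite intU// eq_sym (negbTE ji).
  by rewrite sumr_const mulr_natl.
have intw : \int[mu]_t w t = 1.
  rewrite (proj2 (coord_prod_integrable (P := fun=> Q) iu)).
  by rewrite big1.
(* This l balances AM-GM: w has mass 1 and S^2 w has integral at most |J| k^2 = l^2, so each half
   contributes at most l / 2. *)
pose l := k * Num.sqrt #|J|%:R.
have sJ : 0 < Num.sqrt #|J|%:R :> R by rewrite sqrtr_gt0 ltr0n.
have l0 : 0 < l by rewrite mulr_gt0.
have -> : \sum_(j in J) tensor_int (upd u j h) = \int[mu]_(t in A) (S t * w t).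
  rewrite -Rintegral_sum//; last first.
    move=> j _; apply: (integrableS measurableT) => //.
    by apply: L1_coord_prod; exact: L1_upd.
  apply: eq_Rintegral => t _; rewrite mulr_suml.
  by apply: eq_bigr => j jJ; rewrite wupd.
pose g t := (l / 2) * w t + (l^-1 / 2) * (S t ^+ 2 * w t).
have ig : mu.-integrable setT (EFin \o g).
  have := integrableD measurableT (integrableZl measurableT (l / 2) iw)
    (integrableZl measurableT (l^-1 / 2) iS2).
  by apply: eq_integrable.
have g0 t : 0 <= g t.
  rewrite /g addr_ge0// mulr_ge0 ?divr_ge0 ?invr_ge0 ?(ltW l0)//.
  by rewrite mulr_ge0 ?sqr_ge0.
have Sg t : `|S t * w t| <= g t.
  rewrite normrM (ger0_norm (w0 t)) /g mulrA -mulrDl ler_wpM2r//.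
  rewrite -[S t ^+ 2]real_normK ?num_real//.
  rewrite -subr_ge0.
  have -> : l / 2 + l^-1 / 2 * `|S t| ^+ 2 - `|S t| = (l - `|S t|) ^+ 2 * (l^-1 / 2).
    by field; rewrite gt_eqF.
  by rewrite mulr_ge0 ?sqr_ge0// divr_ge0// invr_ge0 ltW.
have iSwA : mu.-integrable A (EFin \o (fun t => S t * w t)).
  exact: integrableS iSw.
apply: (le_trans (le_normr_Rintegral mA iSwA)).
apply: (@le_trans _ _ (\int[mu]_(t in A) g t)).
  apply: le_Rintegral => //; first exact: integrable_norm.
  exact: integrableS ig.
apply: (@le_trans _ _ (\int[mu]_t g t)).
  apply: fine_le.
  - by apply: integrable_fin_num => //; exact: integrableS ig.
  - exact: integrable_fin_num.
  - apply: ge0_subset_integral => //; first exact: measurable_int ig.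
    by move=> t _; rewrite lee_fin.
rewrite RintegralD//; last 2 first.
- exact: (integrableZl measurableT (l / 2) iw).
- exact: (integrableZl measurableT (l^-1 / 2) iS2).
rewrite !RintegralZl// intw intS2 mulr1 -/l.
have : l^-1 / 2 * (#|J|%:R * \int[Q]_x (h x ^+ 2)) <= l^-1 / 2 * l ^+ 2.
  rewrite ler_wpM2l ?divr_ge0 ?invr_ge0 ?(ltW l0)//.
  by rewrite exprMn sqr_sqrtr// mulrC ler_wpM2r.
move=> /(lerD (lexx (l / 2))); move/le_trans; apply.
have -> : l / 2 + l^-1 / 2 * l ^+ 2 = l by field; rewrite gt_eqF.
exact: lexx.
Qed.

End multilinear_form.

(** * Symmetrization and splitting of the users *)

Lemma upd_perm (n : nat) (X : Type) (u : 'I_n -> X) k v (s : 'S_n) :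
  (fun i => upd u k v (s i)) = upd (fun i => u (s i)) ((s^-1)%g k) v.
Proof. by apply/funext => i; rewrite /upd (canF_eq (permK s)). Qed.

(* The induction step of shuffled_int_mixture: s is the current denominator,
   raised by 1 when the user removed from K joins J. *)
Lemma mix_inv_sqrt_le (R : realType) (g s : R) : 0 < g -> g < 1 -> 1 <= s ->
  g * (Num.sqrt (s + 1))^-1 + (1 - g) * (Num.sqrt s)^-1 <=
  (Num.sqrt (s + g / 2))^-1.
Proof.
move=> g0 g1 s1.
have s0 : 0 < s by exact: lt_le_trans s1.
have s10 : 0 < s + 1 by rewrite addr_gt0.
have sg0 : 0 < s + g / 2 by rewrite addr_gt0// divr_gt0.
set a := (Num.sqrt (s + 1))^-1; set b := (Num.sqrt s)^-1.
have a0 : 0 < a by rewrite invr_gt0 sqrtr_gt0.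
have b0 : 0 < b by rewrite invr_gt0 sqrtr_gt0.
have a2 : a ^+ 2 = (s + 1)^-1 by rewrite exprVn sqr_sqrtr// ltW.
have b2 : b ^+ 2 = s^-1 by rewrite exprVn sqr_sqrtr// ltW.
rewrite -[leLHS]ger0_norm; last first.
  by rewrite addr_ge0// mulr_ge0 ?subr_ge0 ?(ltW g1) ?(ltW g0) ?(ltW a0) ?(ltW b0).
rewrite -sqrtr_sqr -[leRHS]ger0_norm ?invr_ge0// -[leRHS]sqrtr_sqr ler_wsqrtr//.
rewrite [leRHS]exprVn sqr_sqrtr ?(ltW sg0)//.
(* Convexity of the square; the gap is the variance of a two-point law. *)
apply: (@le_trans _ _ (g * a ^+ 2 + (1 - g) * b ^+ 2)).
  rewrite -subr_ge0.
  have -> : g * a ^+ 2 + (1 - g) * b ^+ 2 - (g * a + (1 - g) * b) ^+ 2 =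
    g * (1 - g) * (a - b) ^+ 2 by ring.
  by rewrite mulr_ge0 ?sqr_ge0// mulr_ge0 ?subr_ge0 ?(ltW g0) ?(ltW g1).
rewrite a2 b2 -subr_ge0.
(* The increment g / 2 leaves the numerator g (s - 1 + g), nonnegative because s >= 1. *)
have -> : (s + g / 2)^-1 - (g * (s + 1)^-1 + (1 - g) * s^-1) =
    (g * (s - 1 + g)) / (2 * (s + g / 2) * (s + 1) * s).
  by field; rewrite !gt_eqF//; nra.
rewrite divr_ge0//; first by nra.
by rewrite !mulr_ge0 ?(ltW s0) ?(ltW s10) ?(ltW sg0).
Qed.

Section shuffled_form.
Context d (T : measurableType d) (R : realType) (Q : probability T R) (n : nat).
Variable A : set (n.-tuple T).
Hypothesis mA : measurable A.
Local Notation L1 v := (Q.-integrable setT (EFin \o v)).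

(** The set [A] has no symmetry of its own; the sum over permutations supplies it. Without the
    factor 1 / n!, the bounds below carry n! on the right. *)
Definition shuffled_int (u : 'I_n -> T -> R) : R :=
  \sum_(s : 'S_n) tensor_int Q A (fun i => u (s i)).

Lemma shuffled_int_perm u (t : 'S_n) :
  shuffled_int (fun i => u (t i)) = shuffled_int u.
Proof.
rewrite /shuffled_int [RHS](reindex_inj (mulIg t)); apply: eq_bigr => s _.
by congr tensor_int; apply/funext => i; rewrite permM.
Qed.

Lemma shuffled_int_linear u i v w (a b : R) :
  (forall i, L1 (u i)) -> L1 v -> L1 w ->
  shuffled_int (upd u i (fun x => a * v x + b * w x)) =
  a * shuffled_int (upd u i v) + b * shuffled_int (upd u i w).
Proof.
move=> iu iv iw; rewrite /shuffled_int !mulr_sumr -big_split/=.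
by apply: eq_bigr => s _; rewrite !upd_perm tensor_int_linear.
Qed.

Variables (h : T -> R) (k : R).
Hypotheses (ih : L1 h) (h0 : \int[Q]_x h x = 0).
Hypotheses (ih2 : L1 (fun x => h x ^+ 2)) (hk : \int[Q]_x (h x ^+ 2) <= k ^+ 2).
Hypothesis k0 : 0 < k.

Definition density_family (u : 'I_n -> T -> R) :=
  [/\ forall i, L1 (u i), forall i x, 0 <= u i x
    & forall i, \int[Q]_x u i x = 1].

Lemma density_family_upd u i v : density_family u ->
  L1 v -> (forall x, 0 <= v x) -> \int[Q]_x v x = 1 -> density_family (upd u i v).
Proof.
by move=> [iu u0 u1] iv v0 v1; split => j; rewrite /upd; case: ifP.
Qed.

(* By symmetry h may be moved from i0 to any j in J, so that the form equals
   its average over J. *)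
Lemma shuffled_int_blanket (J : {set 'I_n}) u i0 :
  density_family u -> i0 \in J -> (forall j, j \in J -> u j = cst 1) ->
  `|shuffled_int (upd u i0 h)| <= n`!%:R * (k / Num.sqrt #|J|%:R).
Proof.
move=> [iu u0 u1] i0J uJ.
have J0 : (0 < #|J|)%N by apply/card_gt0P; exists i0.
have sJ : 0 < Num.sqrt #|J|%:R :> R by rewrite sqrtr_gt0 ltr0n.
have avg : #|J|%:R * shuffled_int (upd u i0 h) =
    \sum_(s : 'S_n) \sum_(j in J) tensor_int Q A (fun i => upd u j h (s i)).
  rewrite exchange_big/= mulr_natl -sumr_const; apply: eq_bigr => j jJ.
  (* The transposition of i0 and j moves h to slot j and changes nothing else, since u is 1 at both
     places. *)
  rewrite -/(shuffled_int _) -(shuffled_int_perm (upd u i0 h) (tperm i0 j)).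
  congr shuffled_int; apply/funext => i; rewrite /upd.
  case: tpermP => [->|->|/eqP ii0 /eqP ij].
  - by rewrite eq_sym (uJ _ i0J) (uJ _ jJ).
  - by rewrite !eqxx.
  - by rewrite (negbTE ii0) (negbTE ij).
suff H : #|J|%:R * `|shuffled_int (upd u i0 h)| <= n`!%:R * (k * Num.sqrt #|J|%:R).
  rewrite -(ler_pM2l (_ : 0 < #|J|%:R)) ?ltr0n//; apply: (le_trans H).
  set q := Num.sqrt _ in sJ *; have -> : #|J|%:R = q ^+ 2 by rewrite sqr_sqrtr.
  have -> // : q ^+ 2 * (n`!%:R * (k / q)) = n`!%:R * (k * q).
  by field; rewrite gt_eqF.
rewrite -[#|J|%:R in leLHS]ger0_norm// -normrM avg.
apply: (le_trans (ler_norm_sum _ _ _)).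
rewrite -card_Sn mulr_natl -sumr_const; apply: ler_sum => s _.
(* For a fixed s, the blanket slots of u composed with s form the preimage of [J], which has the
   same cardinal. *)
have -> : \sum_(j in J) tensor_int Q A (fun i => upd u j h (s i)) =
    \sum_(j in (s @^-1: J)) tensor_int Q A (upd (fun i => u (s i)) j h).
  rewrite (reindex_inj (@perm_inj _ s))/=.
  apply: eq_big => [j|j _]; first by rewrite inE.
  by rewrite upd_perm permK.
rewrite -(card_preimset J (@perm_inj _ s)).
apply: tensor_int_sum_le => //.
- by move=> j; rewrite inE => /uJ.
- by rewrite (card_preimset J (@perm_inj _ s)).
Qed.

(* Each user k in K is an independent mixture, g * blanket + (1 - g) * rest;
   K shrinks by one user, who joins the blanket set J or is left aside. *)
Lemma shuffled_int_mixture (g : R) (m : nat) (K J : {set 'I_n}) u i0 :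
  0 < g -> g < 1 -> #|K| = m -> density_family u ->
  i0 \in J -> (forall j, j \in J -> j \notin K) ->
  (forall j, j \in J -> u j = cst 1) -> (forall i x, i \in K -> g <= u i x) ->
  `|shuffled_int (upd u i0 h)| <=
  n`!%:R * (k / Num.sqrt (#|J|%:R + m%:R * (g / 2))).
Proof.
move=> g0 g1; elim: m K J u => [|m IH] K J u Km du i0J JK uJ uK.
  by rewrite mul0r addr0; exact: shuffled_int_blanket.
have [iu u0 u1] := du.
have [l lK] : exists l, l \in K by apply/card_gt0P; rewrite Km.
have lJ : l \notin J by apply: contraTN lK => /JK.
have li0 : l != i0 by apply: contraNneq lJ => ->.
have g1' : 0 < 1 - g by rewrite subr_gt0.
(* The density left over once mass g of the blanket is removed, written as a linear combination so
   that integrability and total mass follow by linearity. *)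
pose r x := (1 - g)^-1 * u l x + (- (g / (1 - g))) * 1.
have i1 : L1 (fun _ => 1) by exact: (finite_measure_integrable_cst _ 1).
have i1' : L1 (cst 1) by exact: i1.
have ir : L1 r.
  exact: (integrableD measurableT (integrableZl measurableT (1 - g)^-1 (iu l))
    (integrableZl measurableT (- (g / (1 - g))) i1)).
have int1 : \int[Q]_x cst 1 x = 1 :> R.
  rewrite Rintegral_cst//= mul1r.
  exact: (congr1 fine (probability_setT Q)).
have r1 : \int[Q]_x r x = 1.
  rewrite /r RintegralD//; last 2 first.
  - exact: (integrableZl measurableT (1 - g)^-1 (iu l)).
  - exact: (integrableZl measurableT (- (g / (1 - g))) i1).
  rewrite !RintegralZl//; try exact: i1; try exact: (iu l).
  by rewrite u1 int1; field; rewrite gt_eqF.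
have r0 x : 0 <= r x.
  have -> : r x = (u l x - g) / (1 - g) by rewrite /r; field; rewrite gt_eqF.
  by rewrite divr_ge0 ?(ltW g1')// subr_ge0 uK.
have ul : u l = fun x => g * cst 1 x + (1 - g) * r x.
  by apply/funext => x; rewrite /r /=; field; rewrite gt_eqF.
have -> : shuffled_int (upd u i0 h) =
    g * shuffled_int (upd (upd u l (cst 1)) i0 h) +
    (1 - g) * shuffled_int (upd (upd u l r) i0 h).
  rewrite !(updC _ _ _ li0) -shuffled_int_linear -?ul//; last exact: L1_upd.
  by rewrite -(upd_neq u h li0) upd_id.
set s : R := #|J|%:R + m%:R * (g / 2).
have B1 : `|shuffled_int (upd (upd u l (cst 1)) i0 h)| <=
    n`!%:R * (k / Num.sqrt (s + 1)).
  have -> : s + 1 = #|l |: J|%:R + m%:R * (g / 2).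
    by rewrite /s cardsU1 lJ add1n -natr1; ring.
  apply: (IH (K :\ l)).
  - by have := cardsD1 l K; rewrite lK Km => -[].
  - exact: density_family_upd.
  - by rewrite !inE i0J orbT.
  - move=> j; rewrite !inE => /predU1P[->|/JK/negbTE->]; first by rewrite eqxx.
    by rewrite andbF.
  - move=> j; rewrite !inE /upd; case: eqVneq => //= _ /uJ //.
  - by move=> i x; rewrite !inE /upd => /andP[/negbTE -> iK]; exact: uK.
(* The leftover density need be neither 1 nor at least g, so l leaves [K] without entering [J]. *)
have B2 : `|shuffled_int (upd (upd u l r) i0 h)| <= n`!%:R * (k / Num.sqrt s).
  apply: (IH (K :\ l) J).
  - by have := cardsD1 l K; rewrite lK Km => -[].
  - exact: density_family_upd.
  - by [].
  - by move=> j /JK/negbTE jK; rewrite !inE jK andbF.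
  - move=> j jJ; rewrite upd_neq ?uJ//.
    by apply: contraNneq lJ => <-.
  - by move=> i x; rewrite !inE /upd => /andP[/negbTE -> iK]; exact: uK.
apply: (le_trans (ler_normD _ _)).
rewrite !normrM (ger0_norm (ltW g0)) (ger0_norm (ltW g1')).
apply: (le_trans (lerD (ler_wpM2l (ltW g0) B1) (ler_wpM2l (ltW g1') B2))).
have -> : g * (n`!%:R * (k / Num.sqrt (s + 1))) +
    (1 - g) * (n`!%:R * (k / Num.sqrt s)) =
    n`!%:R * (k * (g * (Num.sqrt (s + 1))^-1 + (1 - g) * (Num.sqrt s)^-1)) by ring.
have -> : #|J|%:R + m.+1%:R * (g / 2) = s + g / 2 by rewrite /s -natr1; ring.
rewrite ler_wpM2l// ler_wpM2l ?(ltW k0)// mix_inv_sqrt_le//.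
rewrite /s ler_wpDr ?mulr_ge0 ?divr_ge0 ?(ltW g0)//.
by rewrite ler1n; apply/card_gt0P; exists i0.
Qed.

End shuffled_form.

(** * Total variation *)

(** The variation of P - Q is its value on the positive Hahn set minus its value on the negative
    one. Each contributes at most c, and the factor 1/2 in [tv] absorbs the doubling. *)
Lemma tv_le d (T : measurableType d) (R : realType)
    (P Q : {finite_measure set T -> \bar R}) (c : R) :
  (forall A, measurable A -> (`|P A - Q A| <= c%:E)%E) -> (tv P Q <= c%:E)%E.
Proof.
move=> PQ; rewrite /tv; case: cid => p hp; case: cid => q hpq.
have [[mp _] [mq _] _ _] := hpq.
have dE A : diff_charge P Q A = (P A - Q A)%E by [].
rewrite /charge_variation jordan_posE jordan_negE cjordan_posE cjordan_negE.
rewrite /crestr0 !mem_set//= /crestr !setTI.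
rewrite -[leRHS](_ : ((2^-1)%:E * (c + c)%:E)%E = _); last first.
  by rewrite -EFinM; congr EFin; field.
rewrite lee_pmul2l// ?lte_fin ?invr_gt0// EFinD leeD//.
  by apply: le_trans (lee_abs _) _; exact: PQ.
by apply: le_trans (lee_abs _) _; rewrite abseN; exact: PQ.
Qed.

Lemma tv_shuffled_le d (T : measurableType d) (R : realType)
    (Q : probability T R) n (P : 'I_n.+1 -> probability T R)
    (P1' : probability T R) (p : 'I_n.+1 -> T -> R) (p' : T -> R) (g k : R) :
  0 < g -> g < 1 -> 0 < k ->
  (forall i, measurable_fun setT (p i)) -> (forall i x, g <= p i x) ->
  (forall i A, measurable A -> P i A = \int[Q]_(x in A) (p i x)%:E)%E ->
  measurable_fun setT p' -> (forall x, 0 <= p' x) ->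
  (forall A, measurable A -> P1' A = \int[Q]_(x in A) (p' x)%:E)%E ->
  (\int[Q]_x ((p ord0 x - p' x) ^+ 2)%:E <= (k ^+ 2)%:E)%E ->
  (tv (shuffled_law P) (shuffled_law (replace_first P P1')) <=
   (k / Num.sqrt (1 + n%:R * (g / 2)))%:E)%E.
Proof.
move=> g0 g1 k0 mp gp PE mp' p'0 PE' hk.
have p0 i x : 0 <= p i x by exact: le_trans (ltW g0) (gp i x).
have density (P0 : probability T R) (q : T -> R) : measurable_fun setT q ->
    (forall x, 0 <= q x) ->
    (forall A, measurable A -> P0 A = \int[Q]_(x in A) (q x)%:E)%E ->
    Q.-integrable setT (EFin \o q) /\ \int[Q]_x q x = 1.
  move=> mq q0 qE; split; last by rewrite /Rintegral -qE// probability_setT.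
  apply/integrableP; split; first exact/measurable_EFinP.
  under eq_integral do rewrite /= ger0_norm//.
  by rewrite -qE// probability_setT ltry.
have ip i := (density _ _ (mp i) (p0 i) (PE i)).1.
have p1 i := (density _ _ (mp i) (p0 i) (PE i)).2.
have [ip' p'1] := density _ _ mp' p'0 PE'.
have -> : replace_first P P1' = upd P ord0 P1'.
  by apply/funext => i; rewrite /replace_first /upd -val_eqE.
pose u := upd p ord0 p'.
have mu i : measurable_fun setT (u i) by rewrite /u /upd; case: ifP.
have u0 i x : 0 <= u i x by rewrite /u /upd; case: ifP.
have uE i A : measurable A ->
    (upd P ord0 P1' i A = \int[Q]_(x in A) (u i x)%:E)%E.
  by rewrite /u /upd; case: ifP => _; [exact: PE'|exact: PE].
pose h x := p ord0 x - p' x.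
have mh : measurable_fun setT h by exact: measurable_funB.
have ih : Q.-integrable setT (EFin \o h) by exact: (integrableB measurableT (ip ord0) ip').
have h0 : \int[Q]_x h x = 0 by rewrite RintegralB// p1 p'1 subrr.
have ih2 : Q.-integrable setT (EFin \o (fun x => h x ^+ 2)).
  apply/integrableP; split.
    by apply/measurable_EFinP; exact: measurable_funX.
  under eq_integral do rewrite /= ger0_norm ?sqr_ge0//.
  by apply: le_lt_trans hk _; rewrite ltry.
have hk2 : \int[Q]_x (h x ^+ 2) <= k ^+ 2.
  by rewrite -lee_fin /Rintegral fineK//; exact: integrable_fin_num.
apply: tv_le => A mA.
have slE (P0 : 'I_n.+1 -> probability T R) (v : 'I_n.+1 -> T -> R) :
    (forall i, measurable_fun setT (v i)) -> (forall i x, 0 <= v i x) ->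
    (forall i A, measurable A -> P0 i A = \int[Q]_(x in A) (v i x)%:E)%E ->
    shuffled_law P0 A = (n.+1`!%:R^-1 * shuffled_int Q A v)%:E.
  move=> mv v0 vE; rewrite /shuffled_law EFinM /shuffled_int; congr (_ * _)%E.
  rewrite -sumEFin; apply: eq_bigr => s _.
  by apply: (product_law_density (p := fun i => v (s i))) => // i B; exact: vE.
rewrite /= (slE _ _ mp p0 PE) (slE _ _ mu u0 uE) -EFinB abse_EFin lee_fin -mulrBr.
have -> : shuffled_int Q A p - shuffled_int Q A u =
    shuffled_int Q A (upd (upd p ord0 (cst 1)) ord0 h).
  have -> : upd (upd p ord0 (cst 1)) ord0 h = upd p ord0 (fun x => 1 * p ord0 x + (- 1) * p' x).
    apply/funext => i; rewrite /upd; case: eqP => // _.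
    by apply/funext => x; rewrite mul1r mulN1r.
  by rewrite shuffled_int_linear// upd_id mul1r mulN1r.
have i1 : Q.-integrable setT (EFin \o cst 1) by exact: (finite_measure_integrable_cst _ 1).
(* Since h overwrites slot 0, the density there may be set to 1. The blanket set thus starts as {0},
   with the n other users to split: hence 1 + n g / 2. *)
have := @shuffled_int_mixture _ _ _ Q _ A mA h k ih h0 ih2 hk2 k0 g n
  [set~ ord0]%SET [set ord0]%SET (upd p ord0 (cst 1)) ord0 g0 g1.
rewrite cards1 normrM => H.
rewrite ger0_norm ?invr_ge0// mulrC ler_pdivrMr ?ltr0n ?fact_gt0//.
rewrite [leRHS]mulrC; apply: H.
- by rewrite cardsC1 card_ord.
- apply: density_family_upd => //.
  rewrite Rintegral_cst//= mul1r.
  exact: (congr1 fine (probability_setT Q)).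
- by rewrite inE.
- by move=> j; rewrite !inE negbK.
- by move=> j; rewrite inE => /eqP ->; rewrite upd_same.
- by move=> i x; rewrite !inE => i0; rewrite upd_neq.
Qed.

(** * From noise densities to densities relative to the blanket *)

(* [R] and [measurableTypeR R] carry the same sigma-algebra but are distinct
   measurable types: Lebesgue measure lives on the latter, the output laws on
   the former. *)
Section measurable_real_types.
Context (R : realType).

Definition real_to_borel (z : R) : measurableTypeR R := z.

Definition borel_to_real (z : measurableTypeR R) : R := z.

Lemma measurable_real_to_borel : measurable_fun setT real_to_borel.
Proof. by move=> _ Y mY; rewrite setTI. Qed.

Lemma measurable_borel_to_real : measurable_fun setT borel_to_real.
Proof. by move=> _ Y mY; rewrite setTI. Qed.

HB.instance Definition _ :=
  isMeasurableFun.Build _ _ _ _ real_to_borel measurable_real_to_borel.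

HB.instance Definition _ :=
  isMeasurableFun.Build _ _ _ _ borel_to_real measurable_borel_to_real.

Lemma ge0_integral_real_density (Q : probability R R) (q : R -> R)
    (g : R -> \bar R) :
  measurable_fun setT q -> (forall x, 0 <= q x) ->
  (forall A, measurable A -> Q A = \int[lebesgue_measure]_(x in A) (q x)%:E)%E ->
  measurable_fun setT g -> (forall x, 0 <= g x)%E ->
  (\int[Q]_x g x = \int[lebesgue_measure]_x (g x * (q x)%:E))%E.
Proof.
move=> mq q0 QE mg g0.
have <- : (\int[distribution Q real_to_borel]_x g x = \int[Q]_x g x)%E.
  exact: ge0_integral_distribution.
exact: ge0_integral_density.
Qed.

End measurable_real_types.

Lemma output_law_density d (Om : measurableType d) (R : realType)
    (Pr : probability Om R) (Z : {RV Pr >-> R}) (f : R -> R) (x : R) A :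
  measurable_fun setT f -> (forall z, 0 <= f z) ->
  (forall B, measurable B ->
    distribution Pr Z B = \int[lebesgue_measure]_(z in B) (f z)%:E)%E ->
  measurable A ->
  (output_law Z x A = \int[lebesgue_measure]_(z in A) (f (z - x))%:E)%E.
Proof.
move=> mf f0 ZE mA.
pose phi (z : measurableTypeR R) : measurableTypeR R := x + z.
have mphi : measurable_fun setT phi by exact: measurable_funD.
(* Translation invariance, from agreement on half-open intervals. *)
have transl B : measurable B -> lebesgue_measure B = pushforward lebesgue_measure phi B.
  move=> mB; apply: lebesgue_measure_unique => //= _ [[a b]] _ <-.
  rewrite /pushforward.
  have -> : phi @^-1` `]a, b]%classic = `]a - x, b - x]%classic.
    apply/seteqP; split => z /=; rewrite /phi !in_itv/= => /andP[h1 h2];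
    by apply/andP; split; lra.
  rewrite !lebesgue_measure_itv/= !lte_fin ltrD2r; case: ifP => // _.
  by rewrite -!EFinD; congr EFin; ring.
have mfx : measurable_fun setT (fun z : measurableTypeR R => (f (z - x))%:E).
  by apply/measurable_EFinP; apply: (measurableT_comp mf); exact: measurable_funB.
have -> : (\int[lebesgue_measure]_(z in A) (f (z - x))%:E =
    \int[pushforward lebesgue_measure phi]_(z in A) (f (z - x))%:E)%E.
  by apply: eq_measure_integral => //= B mB _; exact: transl.
rewrite (ge0_integral_pushforward mphi)//; first last.
- by move=> z _; rewrite lee_fin.
- exact: measurable_funTS.
have -> : output_law Z x A = distribution Pr Z (phi @^-1` A) by [].
rewrite ZE; last by rewrite -[X in measurable X]setTI; exact: mphi.
by apply: eq_integral => z _; rewrite /phi /= addrC addKr.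
Qed.

(** Relative to Q the output densities are f(z - y) / q(z), so the squared norm of h is the Lebesgue
    integral of (f(z - y) - f(z - y'))^2 / q(z). The function r dominates this integrand up to k^2
    and has mass at most 1, which reduces the norm bound to a pointwise inequality. *)
Lemma tv_shuffled_output_le d (Om : measurableType d) (R : realType)
    (Pr : probability Om R) (Z : {RV Pr >-> R}) (Q : probability R R)
    (f q r : R -> R) (g k : R) n (x : 'I_n.+1 -> R) (x1' : R) :
  0 < g -> g < 1 -> 0 < k ->
  measurable_fun setT f -> measurable_fun setT q -> measurable_fun setT r ->
  (forall z, 0 < q z) -> (forall z, 0 <= r z) ->
  (forall A, measurable A ->
    distribution Pr Z A = \int[lebesgue_measure]_(z in A) (f z)%:E)%E ->
  (forall A, measurable A -> Q A = \int[lebesgue_measure]_(z in A) (q z)%:E)%E ->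
  (\int[lebesgue_measure]_z (r z)%:E <= 1)%E ->
  (forall z, 0 <= f z) ->
  (forall y z, 0 <= y <= 1 -> g * q z <= f (z - y)) ->
  (forall y y' z, 0 <= y <= 1 -> 0 <= y' <= 1 ->
    (f (z - y) - f (z - y')) ^+ 2 <= k ^+ 2 * (q z * r z)) ->
  (forall i, 0 <= x i <= 1) -> 0 <= x1' <= 1 ->
  (tv (shuffled_law (fun i => output_law Z (x i)))
      (shuffled_law (replace_first (fun i => output_law Z (x i))
         (output_law Z x1'))) <=
   (k / Num.sqrt (1 + n%:R * (g / 2)))%:E)%E.
Proof.
move=> g0 g1 k0 mf mq mr q0 r0 ZE QE r1 f0 fg fk x01 x1'01.
pose p y z := f (z - y) / q z.
have mp y : measurable_fun setT (p y).
  apply: measurable_funM; last first.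
    (* Positivity of q lets measurability of the inverse come from exp and ln. *)
    have -> : (fun z => (q z)^-1) = (fun z => expR (- ln (q z))).
      by apply/funext => z; rewrite expRN lnK// posrE.
    apply: (measurableT_comp (@measurable_expR R)); apply: measurableT_comp => //.
    exact: (measurableT_comp (@measurable_ln R)).
  by apply: (measurableT_comp mf); exact: measurable_funB.
have p0 y z : 0 <= p y z by rewrite divr_ge0// ltW.
have q0' z : 0 <= q z by exact: ltW.
have pE y A : measurable A -> (output_law Z y A = \int[Q]_(z in A) (p y z)%:E)%E.
  move=> mA; rewrite (output_law_density _ mf f0 ZE)//.
  rewrite [RHS]integral_mkcond.
  rewrite (ge0_integral_real_density mq q0' QE); first last.
  - by move=> z; rewrite patchE; case: ifP => // _; rewrite lee_fin.
  - by apply/(measurable_restrictT _ mA)/measurable_funTS/measurable_EFinP.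
  rewrite [LHS]integral_mkcond; apply: eq_integral => z _; rewrite !patchE.
  case: ifP => _; last by rewrite mul0e.
  by rewrite -EFinM /p divfK// gt_eqF.
have mh : measurable_fun setT (fun z => (p (x ord0) z - p x1' z) ^+ 2).
  by apply/measurable_funX/measurable_funB.
apply: (@tv_shuffled_le _ _ _ Q n _ _ (fun i => p (x i)) (p x1') g k) => //.
- by move=> i z; rewrite /p ler_pdivlMr// fg.
- by move=> i A; exact: pE.
- by move=> A; exact: pE.
rewrite (ge0_integral_real_density mq q0' QE); first last.
- by move=> z; rewrite lee_fin sqr_ge0.
- exact/measurable_EFinP.
apply: (@le_trans _ _ (\int[lebesgue_measure]_z ((k ^+ 2)%:E * (r z)%:E)%E)%E).
  apply: ge0_le_integral => //.
  - by move=> z _; rewrite mule_ge0// lee_fin ?sqr_ge0.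
  - by apply: emeasurable_funM; apply/measurable_EFinP; [exact: mh|exact: mq].
  - apply: emeasurable_funM; first exact: measurable_cst.
    by apply/measurable_EFinP; exact: mr.
  move=> z _; rewrite -!EFinM lee_fin /p -mulrBl exprMn.
  have -> a : a * (q z)^-1 ^+ 2 * q z = a / q z by field; rewrite gt_eqF.
  by rewrite ler_pdivrMr// -mulrA [r z * _]mulrC fk.
rewrite ge0_integralZl ?lee_fin ?sqr_ge0//; first last.
- by move=> z _; rewrite lee_fin.
- by apply/measurable_EFinP; exact: mr.
by rewrite -[leRHS]mule1 lee_wpmul2l// lee_fin sqr_ge0.
Qed.

Lemma expR_dist_le (R : realType) (a b M : R) : a <= M -> b <= M ->
  `|expR a - expR b| <= `|a - b| * expR M.
Proof.
wlog ba : a b / b <= a => [hw aM bM|aM _].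
  have [|/ltW] := leP b a; first by move/hw; exact.
  by move/hw => /(_ bM aM); rewrite distrC [`|b - a|]distrC.
rewrite !ger0_norm ?subr_ge0 ?ler_expR//.
apply: (@le_trans _ _ ((a - b) * expR a)); last first.
  by rewrite ler_wpM2l ?subr_ge0// ler_expR.
have -> : expR b = expR (b - a) * expR a by rewrite -expRD subrK.
rewrite -{1}[expR a]mul1r -mulrBl ler_wpM2r ?expR_ge0//.
by have := expR_ge1Dx (b - a); lra.
Qed.

(** * The Laplace and Gaussian mechanisms *)

Section noise_mechanisms.
Context (R : realType).
Implicit Types (b c eps y z : R).

Lemma laplace_pdf_gt0 b z : 0 < b -> 0 < laplace_pdf b z.
Proof. by move=> b0; rewrite mulr_gt0 ?expR_gt0// invr_gt0 mulr_gt0. Qed.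

Lemma measurable_laplace_pdf b : measurable_fun setT (laplace_pdf b : R -> R).
Proof.
apply: measurable_funM => //; apply: measurableT_comp => //.
apply: measurable_funM => //; apply: measurableT_comp => //.
Qed.

Lemma laplace_pdfE eps z :
  laplace_pdf (1 / eps) z = (2 * (1 / eps))^-1 * expR (- (eps * `|z|)).
Proof. by rewrite /laplace_pdf div1r invrK mulNr [`|z| * _]mulrC. Qed.

(** A shift by at most 1 moves the exponent by at most eps < 1, so the noise law itself can be the
    blanket. *)
Lemma laplace_pdf_shift_ge eps y z : 0 < eps -> eps < 1 -> 0 <= y <= 1 ->
  expR (-1) * laplace_pdf (1 / eps) z <= laplace_pdf (1 / eps) (z - y).
Proof.
move=> e0 e1 /andP[y0 y1]; rewrite !laplace_pdfE mulrCA ler_wpM2l//.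
  by rewrite invr_ge0 mulr_ge0// divr_ge0// ltW.
rewrite -expRD ler_expR.
have : `|z - y| <= `|z| + y by rewrite (le_trans (ler_normB _ _))// (ger0_norm y0).
by nra.
Qed.

Lemma laplace_pdf_shift_dist eps y y' z : 0 < eps -> eps < 1 ->
  0 <= y <= 1 -> 0 <= y' <= 1 ->
  `|laplace_pdf (1 / eps) (z - y) - laplace_pdf (1 / eps) (z - y')| <=
  eps * expR 1 * laplace_pdf (1 / eps) z.
Proof.
move=> e0 e1 /andP[y0 y1] /andP[y'0 y'1]; rewrite !laplace_pdfE -mulrBr normrM.
have : 0 <= (2 * (1 / eps))^-1 by rewrite invr_ge0 mulr_ge0// divr_ge0// ltW.
move: (_^-1) => c c0; rewrite (ger0_norm c0) mulrCA ler_wpM2l//.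
have lip t : 0 <= t <= 1 -> - (eps * `|z - t|) <= 1 - eps * `|z|.
  move=> /andP[t0 t1].
  have : `|z| <= `|z - t| + t by rewrite -{2}(ger0_norm t0) -{1}(subrK t z) ler_normD.
  by nra.
apply: (le_trans (@expR_dist_le _ _ _ (1 - eps * `|z|) _ _)).
- by apply: lip; rewrite y0.
- by apply: lip; rewrite y'0.
rewrite -[leRHS]mulrA -expRD ler_wpM2r ?expR_ge0//.
have -> : - (eps * `|z - y|) - - (eps * `|z - y'|) =
    eps * (`|z - y'| - `|z - y|) by ring.
rewrite normrM (gtr0_norm e0) ler_piMr ?(ltW e0)//.
apply: (le_trans (ler_dist_dist _ _)).
have -> : z - y' - (z - y) = y - y' by ring.
by rewrite ler_norml; apply/andP; split; lra.
Qed.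

(** In units of 1 / eps, all scales share one peak factor and z enters only through eps * z; the
    Gaussian estimates become inequalities in s = eps * z. *)
Lemma normal_pdf_scaleE c eps z : 0 < c -> 0 < eps ->
  normal_pdf 0 (c / eps) z =
  c^-1 * normal_peak eps^-1 * expR (- ((eps * z) ^+ 2 / (2 * c ^+ 2))).
Proof.
move=> c0 e0; rewrite normal_pdfE ?gt_eqF ?divr_gt0// /normal_peak /normal_fun.
congr (_ * expR _).
  have -> : (c / eps) ^+ 2 * pi *+ 2 = c ^+ 2 * (eps^-1 ^+ 2 * pi *+ 2) :> R.
    by field; rewrite gt_eqF.
  by rewrite sqrtrM ?sqr_ge0// sqrtr_sqr gtr0_norm// invfM.
by field; rewrite !gt_eqF.
Qed.

Lemma normal_pdf_gt0 c z : 0 < c -> 0 < normal_pdf 0 c z.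
Proof.
move=> c0; rewrite normal_pdfE ?gt_eqF//.
by rewrite mulr_gt0 ?expR_gt0// normal_peak_gt0// gt_eqF.
Qed.

Lemma normal_pdf_shift_ge eps y z : 0 < eps -> eps < 1 -> 0 <= y <= 1 ->
  expR (- 4) * normal_pdf 0 ((9 / 10) / eps) z <= normal_pdf 0 (1 / eps) (z - y).
Proof.
move=> e0 e1 /andP[y0 y1]; rewrite !normal_pdf_scaleE ?divr_gt0// invr1 mul1r.
have pk0 : 0 <= normal_peak eps^-1 by exact: normal_peak_ge0.
move: (normal_peak _) pk0 => pk pk0.
have -> (i u v : R) : u * (i * pk * v) = pk * (i * (u * v)) by ring.
rewrite ler_wpM2l//.
(* The ratio 10/9 of the peaks uses up 1 of the 4 units in the exponent. *)
have b1 : (9 / 10)^-1 <= expR 1 :> R.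
  by apply: le_trans (expR_ge1Dx 1); lra.
apply: (@le_trans _ _ (expR 1 * (expR (- 4) *
    expR (- ((eps * z) ^+ 2 / (2 * (9 / 10) ^+ 2)))))).
  by rewrite ler_wpM2r// mulr_ge0 ?expR_ge0.
rewrite -!expRD ler_expR.
set s := eps * z.
have -> : eps * (z - y) = s - eps * y by rewrite mulrBr.
set a := eps * y.
have a0 : 0 <= a by rewrite mulr_ge0// ltW.
have a1 : a <= 1 by rewrite /a; nra.
(* Divided by 702, this gives - s a <= 3/26 s^2 + 13/6 a^2, where 3/26 < 50/81 - 1/2 and 13/6 + 1/2
   < 3. *)
have : 0 <= (9 * s + 39 * a) ^+ 2 by exact: sqr_ge0.
have : 0 <= s ^+ 2 by exact: sqr_ge0.
have : a ^+ 2 <= 1 by rewrite expr_le1.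
lra.
Qed.

(* The blanket N(0, (9 / (10 eps))^2) must have lighter tails than the shifted
   densities yet not so light that h leaves L^2: in units of 1 / eps, the square
   on the left is O(s^2 exp(- 9/10 s^2)), while the right-hand side decays as
   exp(- (50/81 + 1/8) s^2), where 50/81 + 1/8 < 3/4. *)
Lemma normal_pdf_shift_dist eps y y' z : 0 < eps -> eps < 1 ->
  0 <= y <= 1 -> 0 <= y' <= 1 ->
  (normal_pdf 0 (1 / eps) (z - y) - normal_pdf 0 (1 / eps) (z - y')) ^+ 2 <=
  (6 * expR 5 * eps) ^+ 2 *
    (normal_pdf 0 ((9 / 10) / eps) z * normal_pdf 0 (2 / eps) z).
Proof.
move=> e0 e1 /andP[y0 y1] /andP[y'0 y'1]; rewrite !normal_pdf_scaleE ?divr_gt0//.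
rewrite invr1 mul1r -mulrBr exprMn.
set pk := normal_peak _; set s := eps * z.
have shift t : eps * (z - t) = s - eps * t by rewrite mulrBr.
rewrite !shift.
set a := eps * y; set a' := eps * y'.
have a0 : 0 <= a by rewrite mulr_ge0// ltW.
have a1 : a <= 1 by rewrite /a; nra.
have a'0 : 0 <= a' by rewrite mulr_ge0// ltW.
have a'1 : a' <= 1 by rewrite /a'; nra.
(* From s t <= s^2 / 20 + 5 t^2: the cross term costs a tenth of the Gaussian decay and a
   constant. *)
set M := 9 / 2 - 9 / 20 * s ^+ 2.
have leM t : 0 <= t -> t <= 1 -> - ((s - t) ^+ 2 / (2 * 1 ^+ 2)) <= M.
  move=> t0 t1; have : 0 <= (s - 10 * t) ^+ 2 by exact: sqr_ge0.
  by rewrite /M; nra.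
have h1 := expR_dist_le (leM _ a0 a1) (leM _ a'0 a'1).
have h2 : `|- ((s - a) ^+ 2 / (2 * 1 ^+ 2)) - - ((s - a') ^+ 2 / (2 * 1 ^+ 2))| <=
    eps * (`|s| + 1).
  have -> : - ((s - a) ^+ 2 / (2 * 1 ^+ 2)) - - ((s - a') ^+ 2 / (2 * 1 ^+ 2)) =
    (a - a') * (s - (a + a') / 2) by field.
  rewrite normrM ler_pM//.
    rewrite /a /a' -mulrBr normrM (gtr0_norm e0) ler_piMr ?(ltW e0)//.
    by rewrite ler_norml; apply/andP; split; lra.
  rewrite (le_trans (ler_normB _ _))// lerD2l ger0_norm; lra.
have h3 : (expR (- ((s - a) ^+ 2 / (2 * 1 ^+ 2))) -
    expR (- ((s - a') ^+ 2 / (2 * 1 ^+ 2)))) ^+ 2 <=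
    eps ^+ 2 * ((`|s| + 1) ^+ 2 * expR M ^+ 2).
  rewrite -[leLHS]real_normK ?num_real// -!exprMn lerXn2r ?nnegrE//.
    by rewrite !mulr_ge0 ?expR_ge0 ?(ltW e0)// addr_ge0.
  by apply: (le_trans h1); rewrite [leRHS]mulrA ler_wpM2r ?expR_ge0.
(* The polynomial factor is traded for exp(3/20 s^2); with exp(M)^2 this leaves exp(9 - 3/4 s^2). *)
have h4 : (`|s| + 1) ^+ 2 <= 14 * expR (3 / 20 * s ^+ 2).
  have := expR_ge1Dx (3 / 20 * s ^+ 2).
  have : `|s| ^+ 2 = s ^+ 2 by rewrite real_normK ?num_real.
  have : 0 <= (`|s| - 1) ^+ 2 by exact: sqr_ge0.
  by have : 0 <= s ^+ 2 by [exact: sqr_ge0]; nra.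
have h5 : expR (3 / 20 * s ^+ 2) * expR M ^+ 2 <= expR 5 ^+ 2 *
    (expR (- (s ^+ 2 / (2 * (9 / 10) ^+ 2))) * expR (- (s ^+ 2 / (2 * 2 ^+ 2)))).
  rewrite !expr2 -!expRD ler_expR /M.
  by have : 0 <= s ^+ 2 by [exact: sqr_ge0]; lra.
set E := expR (- (s ^+ 2 / (2 * (9 / 10) ^+ 2))) * expR _ in h5 *.
have E0 : 0 <= E by rewrite mulr_ge0 ?expR_ge0.
(* Here 6^2 * (10/9) * (1/2) = 20, enough to cover the 14 of [h4]. *)
have -> : (6 * expR 5 * eps) ^+ 2 *
    ((9 / 10)^-1 * pk * expR (- (s ^+ 2 / (2 * (9 / 10) ^+ 2))) *
     (2^-1 * pk * expR (- (s ^+ 2 / (2 * 2 ^+ 2))))) =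
    pk ^+ 2 * (eps ^+ 2 * (20 * (expR 5 ^+ 2 * E))) by rewrite /E; field.
rewrite ler_wpM2l ?sqr_ge0//; apply: (le_trans h3).
rewrite ler_wpM2l ?sqr_ge0//.
apply: (@le_trans _ _ (14 * expR (3 / 20 * s ^+ 2) * expR M ^+ 2)).
  by rewrite ler_wpM2r ?sqr_ge0.
rewrite -mulrA; apply: (@le_trans _ _ (14 * (expR 5 ^+ 2 * E))).
  by rewrite ler_wpM2l.
by rewrite ler_wpM2r ?mulr_ge0 ?sqr_ge0// ler_nat.
Qed.

End noise_mechanisms.

(** The constants exp(-4) and 6 exp(5) come from the Gaussian case; the Laplace case, with q and r
    both the noise density, satisfies sharper bounds that are weakened to match. *)
Lemma tv_shuffled_noise_le (R : realType) (eps : R) d (Om : measurableType d)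
    (Pr : probability Om R) (Z : {RV Pr >-> R}) :
  0 < eps < 1 ->
  has_law Z (laplace_prob (1 / eps)) \/ has_law Z (normal_prob 0 (1 / eps)) ->
  forall n (x : 'I_n.+1 -> R) (x1' : R),
  (forall i, 0 <= x i <= 1) -> 0 <= x1' <= 1 ->
  (tv (shuffled_law (fun i => output_law Z (x i)))
      (shuffled_law (replace_first (fun i => output_law Z (x i))
         (output_law Z x1'))) <=
   (6 * expR 5 * eps / Num.sqrt (1 + n%:R * (expR (- 4) / 2)))%:E)%E.
Proof.
move=> /andP[e0 e1] laws n x x1' x01 x1'01.
have g0 : 0 < expR (- 4) :> R by exact: expR_gt0.
have g1 : expR (- 4) < 1 :> R by rewrite -[ltRHS]expR0 ltr_expR; lra.
have k0 : 0 < 6 * expR 5 * eps by rewrite !mulr_gt0 ?expR_gt0.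
have [ZE|ZE] := laws.
- have f0 z : 0 < laplace_pdf (1 / eps) z by rewrite laplace_pdf_gt0// divr_gt0.
  have f0' z : 0 <= laplace_pdf (1 / eps) z by exact: ltW.
  have mf := measurable_laplace_pdf (1 / eps).
  apply: (@tv_shuffled_output_le _ _ _ _ _ (distribution Pr Z)
    (laplace_pdf (1 / eps)) (laplace_pdf (1 / eps)) (laplace_pdf (1 / eps))) => //.
  + rewrite -[leLHS]/(laplace_prob (1 / eps) setT) -ZE//.
    exact: (probability_le1 (distribution Pr Z)).
  + move=> y z y01; apply: le_trans (laplace_pdf_shift_ge z e0 e1 y01).
    by rewrite ler_wpM2r// ler_expR; lra.
  + move=> y y' z y01 y'01; rewrite -expr2 -exprMn -[leLHS]real_normK ?num_real//.
    rewrite lerXn2r ?nnegrE//; first by rewrite mulr_ge0// ltW.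
    apply: (le_trans (laplace_pdf_shift_dist z e0 e1 y01 y'01)).
    rewrite ler_wpM2r// [leLHS]mulrC ler_wpM2r ?(ltW e0)//.
    have : expR 1 <= expR 5 :> R by rewrite ler_expR; lra.
    by have : 0 < expR 5 :> R by [exact: expR_gt0]; lra.
- have pdf0 c z : 0 < c -> 0 < normal_pdf 0 (c / eps) z.
    by move=> c0; rewrite normal_pdf_gt0// divr_gt0.
  apply: (@tv_shuffled_output_le _ _ _ _ _
    (distribution (normal_prob 0 ((9 / 10) / eps)) (@borel_to_real R))
    (normal_pdf 0 (1 / eps)) (normal_pdf 0 ((9 / 10) / eps))
    (normal_pdf 0 (2 / eps))) => //.
  + exact: measurable_normal_pdf.
  + exact: measurable_normal_pdf.
  + exact: measurable_normal_pdf.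
  + by move=> z; apply: pdf0; rewrite divr_gt0.
  + by move=> z; apply: normal_pdf_ge0.
  + by rewrite integral_normal_pdf.
  + by move=> z; apply: normal_pdf_ge0.
  + by move=> y z; exact: normal_pdf_shift_ge.
  + by move=> y y' z; exact: normal_pdf_shift_dist.
Qed.

Theorem lemma2p2 (R : realType) :
  exists C : R, 0 < C /\
  forall (n : nat) (x : 'I_n -> R) (x1' : R) (eps : R)
    (d : measure_display) (Om : measurableType d) (Pr : probability Om R)
    (Z : {RV Pr >-> R}),
    (2 <= n)%N ->
    (forall i, 0 <= x i <= 1) ->
    0 <= x1' <= 1 ->
    0 < eps < 1 ->
    has_law Z (laplace_prob (1 / eps)) \/ has_law Z (normal_prob 0 (1 / eps)) ->
    let P := fun i => output_law Z (x i) in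
    let P' := replace_first P (output_law Z x1') in
    (tv (shuffled_law P) (shuffled_law P') <= (C * (eps / Num.sqrt n%:R))%:E)%E.
Proof.
(* With g = exp(-4) <= 1 and n users besides the first, 1 + n g / 2 >= (n + 1) g / 2; this yields
   the factor sqrt(2 / g). *)
exists (6 * expR 5 * Num.sqrt (2 / expR (- 4))).
have g0 : 0 < expR (- 4) :> R by exact: expR_gt0.
have g1 : expR (- 4) <= 1 :> R by rewrite -[leRHS]expR0 ler_expR; lra.
split; first by rewrite !mulr_gt0 ?expR_gt0// sqrtr_gt0 divr_gt0.
move=> [//|n] x x1' eps d Om Pr Z _ x01 x1'01 e01 laws /=.
apply: (le_trans (tv_shuffled_noise_le e01 laws x01 x1'01)).
have /andP[e0 _] := e01; rewrite lee_fin.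
have -> : 6 * expR 5 * Num.sqrt (2 / expR (- 4)) * (eps / Num.sqrt n.+1%:R) =
    6 * expR 5 * eps * (Num.sqrt (2 / expR (- 4)) / Num.sqrt n.+1%:R) by ring.
rewrite ler_wpM2l//; first by rewrite !mulr_ge0 ?expR_ge0 ?(ltW e0).
have n0 : 0 <= n%:R :> R by [].
have p0 : 0 < 1 + n%:R * (expR (- 4) / 2) :> R.
  by rewrite ltr_pwDl// mulr_ge0 ?divr_ge0 ?expR_ge0.
rewrite -!sqrtrV ?(ltW p0)// -sqrtrM ?divr_ge0 ?expR_ge0// ler_wsqrtr//.
have -> : 2 / expR (- 4) * n.+1%:R^-1 = (expR (- 4) / 2 * n.+1%:R)^-1 :> R.
  by rewrite invfM invf_div.
rewrite lef_pV2 ?posrE ?mulr_gt0 ?divr_gt0//.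
by rewrite -[n.+1%:R]natr1; lra.
Qed.
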